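(* Consider the problem $\min\phi(x)$ over $x\in C$ subject to $c(x)=0$, with $\mathcal{F}=\{x\in C\mid c(x)=0\}$, and the projected gradient/antigradient flow $$\dot x(t)=P_{T(C,x(t))}\bigl(-\nabla_xL^{\rho}(x(t),y(t))\bigr),\qquad\dot y(t)=\nabla_yL^{\rho}(x(t),y(t)).$$ Equilibrium points $(\bar x,\bar y)\in C\times Y$ of this flow (points with $P_{T(C,\bar x)}(-\nabla_xL^{\rho}(\bar x,\bar y))=0$ and $\nabla_yL^{\rho}(\bar x,\bar y)=0$) are critical points of the problem, i.e. $(\bar x,\bar y)\in\mathcal{F}\times Y$ and $-\nabla\phi(\bar x)-\nabla c(\bar x)\bar y\in T^-(C,\bar x)$; and, vice versa, every critical point of the problem is an equilibrium point of the flow.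
   Context: Setting and standing assumptions: $X,Y$ are real Hilbert spaces, $C\subseteq X$ is nonempty, closed and convex, $\phi:X\to\mathbb{R}$ and $c:X\to Y$ are twice continuously Fréchet differentiable. Gradients are Riesz representatives; $\nabla c(x)=(c'(x))^{\star}\in\mathcal{L}(Y,X)$ is the Hilbert space adjoint of $c'(x)$. For a fixed $\rho\in\mathbb{R}_{\ge0}$, $\phi^{\rho}(x)=\phi(x)+\frac{\rho}{2}\|c(x)\|_Y^2$ and $L^{\rho}(x,y)=\phi^{\rho}(x)+(y,c(x))_Y$, so $\nabla_xL^{\rho}(x,y)=\nabla\phi(x)+\nabla c(x)[y+\rho c(x)]$ and $\nabla_yL^{\rho}(x,y)=c(x)$. It is assumed throughout that: the range of $c'(x)$ is closed in $Y$ for all $x\in\mathcal{F}$; $\inf_{x\in C}\phi^{\rho}(x)>-\infty$ and $\phi^{\rho}(x)\to\infty$ as $\|x\|_X\to\infty$; $c$, $L^{\rho}$ and $\nabla L^{\rho}$ are locally Lipschitz continuous. Tangent cone: $T(M,\bar x)=\{d\in X\mid$ there exist $(x_k)\subset M$, $(\lambda_k)\subset\mathbb{R}_{\ge0}$ with $x_k\to\bar x$, $\lambda_k(x_k-\bar x)\to d\}$. Polar cone: $K^-=\{d\in X\mid(d,x)_X\le0\ \forall x\in K\}$, and $T^-(C,\bar x)=(T(C,\bar x))^-$. $P_K$ is the metric projection onto a nonempty closed convex set $K$. *)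

(* Defs.v *)
From HB Require Import structures.
From mathcomp Require Import all_boot all_order all_algebra.
From mathcomp Require Import sesquilinear.
From mathcomp Require Import all_classical all_reals all_analysis.

Set Implicit Arguments.
Unset Strict Implicit.
Unset Printing Implicit Defensive.

Import Order.TTheory GRing.Theory Num.Theory.
Import numFieldNormedType.Exports.

Local Open Scope classical_set_scope.
Local Open Scope ring_scope.

(* A real Hilbert space is a complete normed module whose norm comes from an
   inner product. [{dot H for idfun}] is the type of symmetric positive
   definite bilinear forms on H. *)
HB.mixin Record CompleteNormedModule_isHilbert (R : realType) H
    & CompleteNormedModule R H := {
  inner : {dot H for idfun} ;
  inner_sqr_norm : forall x : H, inner x x = `|x| ^+ 2
}.

#[short(type="hilbertType")]
HB.structure Definition Hilbert (R : realType) :=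
  {H of CompleteNormedModule R H & CompleteNormedModule_isHilbert R H}.

(* The values [0] and [x] below, used when the defining property has no
   solution, are never reached for a continuous linear map (Riesz), respectively
   for a nonempty closed convex set (projection theorem). *)

Definition riesz (R : realType) (H : hilbertType R) (l : H -> R) : H :=
  xget 0 [set g | forall h, inner g h = l h].

Definition gradient (R : realType) (H : hilbertType R) (f : H -> R^o) (x : H)
    : H :=
  riesz ('d f x : H -> R).

Definition adjoint (R : realType) (X Y : hilbertType R) (A : X -> Y) (y : Y)
    : X :=
  riesz (fun h => inner y (A h)).

Definition proj (R : realType) (H : hilbertType R) (K : set H) (x : H) : H :=
  xget x [set p | K p /\ forall q, K q -> `|x - p| <= `|x - q|].

(* The library has no normed space of continuous linear maps, so this spells
   out the operator norm: x |-> 'd f x, a map into L(V, W), is differentiable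
   with a derivative D2, D2 x : L(V, L(V, W)) being seen as a bounded bilinear
   map, and D2 is continuous. Continuity of x |-> 'd f x follows. *)
Definition twice_continuously_differentiable (R : realType)
    (V W : normedModType R) (f : V -> W) : Prop :=
  (forall x, differentiable f x) /\
  exists D2 : V -> {bilinear V -> V -> W},
    [/\ forall x, exists M : R, forall k h, `|D2 x k h| <= M * `|k| * `|h|,
        forall x (e : R), 0 < e -> \forall k \near (0 : V), forall h,
          `|'d f (x + k) h - 'd f x h - D2 x k h| <= e * `|k| * `|h|
      & forall x (e : R), 0 < e -> \forall x' \near x, forall k h,
          `|D2 x' k h - D2 x k h| <= e * `|k| * `|h| ].

Definition locally_lipschitz (R : realType) (V W : normedModType R)
    (f : V -> W) : Prop :=
  [locally [lipschitz f x | x in setT]].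

Definition tangent_cone (R : realType) (V : normedModType R) (M : set V)
    (x : V) : set V :=
  [set d | exists (u : nat -> V) (lambda : nat -> R),
    [/\ forall k, M (u k),
        forall k, 0 <= lambda k,
        u k @[k --> \oo] --> x
      & lambda k *: (u k - x) @[k --> \oo] --> d]].

Definition polar_cone (R : realType) (H : hilbertType R) (K : set H) : set H :=
  [set d | forall x, K x -> inner d x <= 0].

Section problem.
Context (R : realType) (X Y : hilbertType R).
Variables (C : set X) (phi : X -> R) (c : X -> Y) (rho : R).

Definition feasible : set X := [set x | C x /\ c x = 0].

Definition aug_objective (x : X) : R := phi x + rho / 2 * `|c x| ^+ 2.

Definition aug_lagrangian (x : X) (y : Y) : R :=
  aug_objective x + inner y (c x).

Definition gradx_lagrangian (x : X) (y : Y) : X :=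
  gradient (fun x' => aug_lagrangian x' y) x.

Definition grady_lagrangian (x : X) (y : Y) : Y :=
  gradient (fun y' => aug_lagrangian x y') y.

(* The right-hand side of the flow (x', y') = flow_field (x, y). *)
Definition flow_field (z : X * Y) : X * Y :=
  (proj (tangent_cone C z.1) (- gradx_lagrangian z.1 z.2),
   grady_lagrangian z.1 z.2).

Definition equilibrium_point (x : X) (y : Y) : Prop :=
  C x /\ flow_field (x, y) = (0, 0).

Definition critical_point (x : X) (y : Y) : Prop :=
  feasible x /\
  polar_cone (tangent_cone C x)
    (- gradient phi x - adjoint ('d c x : X -> Y) y).

End problem.

(* Main.v *)
(* Since the y-gradient of the augmented Lagrangian is [c x], equilibria are
   feasible; at a feasible point the penalty term does not contribute to the
   x-gradient, which is then [gradient phi x + adjoint ('d c x) y]. It remains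
   that, for a cone [K] and a vector [g], [proj K g = 0] iff [g] lies in the
   polar of [K]: expand [|g|^2 <= |g - t d|^2] and let [t] tend to [0]. *)
Require Import Defs.
From HB Require Import structures.
From mathcomp Require Import all_boot all_order all_algebra.
From mathcomp Require Import sesquilinear ring lra.
From mathcomp Require Import all_classical all_reals all_analysis.
Import Order.TTheory GRing.Theory Num.Theory.
Import numFieldNormedType.Exports.
Local Open Scope classical_set_scope.
Local Open Scope ring_scope.

(** * Inner product identities and the Riesz representation theorem *)

Section inner_product.
Context {R : realType} {H : hilbertType R}.
Implicit Types u v w h : H.

Lemma innerC u v : inner u v = inner v u :> R.
Proof. by rewrite hermC expr0 mul1r. Qed.

Lemma innerDl u v w : inner (u + v) w = inner u w + inner v w :> R.
Proof. exact: linearDl. Qed.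

Lemma innerDr u v w : inner w (u + v) = inner w u + inner w v :> R.
Proof. exact: linearDr. Qed.

Lemma innerZl (a : R) u v : inner (a *: u) v = a * inner u v.
Proof. by rewrite linearZl_LR. Qed.

Lemma innerZr (a : R) u v : inner u (a *: v) = a * inner u v.
Proof. by rewrite innerC innerZl innerC. Qed.

Lemma innerNl u v : inner (- u) v = - inner u v :> R.
Proof. by rewrite -scaleN1r innerZl mulN1r. Qed.

Lemma innerNr u v : inner u (- v) = - inner u v :> R.
Proof. by rewrite innerC innerNl innerC. Qed.

Lemma inner0l v : inner 0 v = 0 :> R.
Proof. by rewrite -(scale0r 0) innerZl mul0r. Qed.

Lemma sqr_normD u v : `|u + v| ^+ 2 = `|u| ^+ 2 + 2 * inner u v + `|v| ^+ 2.
Proof.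
rewrite -!inner_sqr_norm innerDl !innerDr (innerC v u).
by rewrite mulr_natl mulr2n !addrA.
Qed.

Lemma inner_inj u v : (forall h, inner u h = inner v h :> R) -> u = v.
Proof.
move=> uv; apply/eqP; rewrite -subr_eq0 -normr_eq0 -sqrf_eq0.
by rewrite -inner_sqr_norm innerDl innerNl uv subrr.
Qed.

(** Representatives are unique by [inner_inj], so exhibiting one determines the choice made by
    [riesz]. *)
Lemma riesz_rep {l : H -> R} {g} : (forall h, inner g h = l h) -> riesz l = g.
Proof.
move=> gl; apply: xget_unique => // g' g'l; apply: inner_inj => h.
by rewrite gl g'l.
Qed.

(** Polarization expresses the inner product through norms, which are continuous. *)
Lemma inner_continuous : continuous (fun p : H * H => inner p.1 p.2 : R^o).
Proof.
have -> : (fun p : H * H => inner p.1 p.2 : R^o) =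
    (fun p => (`|p.1 + p.2| ^+ 2 - `|p.1| ^+ 2 - `|p.2| ^+ 2) / 2).
  by apply/funext => p; rewrite sqr_normD; field.
have sqr_norm_cvg (f : H * H -> H) p : f q @[q --> p] --> f p ->
    `|f q| ^+ 2 @[q --> p] --> (`|f p| ^+ 2 : R).
  move=> fp; apply: (continuous_cvg _ (@exprn_continuous _ _ _)).
  exact: cvg_norm.
move=> p; apply: cvgM; last exact: cvg_cst.
apply: cvgB; first apply: cvgB; apply: sqr_norm_cvg.
- by apply: cvgD; [exact: cvg_fst|exact: cvg_snd].
- exact: cvg_fst.
- exact: cvg_snd.
Qed.

(** This is the first-order optimality condition along a ray: for small [t] the linear term
    dominates. *)
Lemma ge0_of_quadratic_ge0 (a b : R) : 0 <= b ->
  (forall t, 0 < t -> 0 <= 2 * t * a + t ^+ 2 * b) -> 0 <= a.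
Proof.
move=> b0 ab; rewrite leNgt; apply/negP => a0.
have b1 : 0 < b + 1 by lra.
(* At this [t] the quadratic equals [- t ^+ 2 * (b + 2)]; the [+ 1] covers [b = 0]. *)
have t0 : 0 < - a / (b + 1) by rewrite divr_gt0// oppr_gt0.
have := ab _ t0; set t := - a / (b + 1) in t0 *.
have -> : a = - t * (b + 1) by rewrite /t; field; rewrite gt_eqF.
have : 0 < t ^+ 2 by rewrite exprn_gt0.
nra.
Qed.

(* The representative is the minimizer of [J z = |z|^2 - 2 l z], whose
   minimizing sequences are Cauchy by the parallelogram identity. *)
Lemma riesz_representation (l : {linear H -> R^o}) :
  continuous l -> exists g, forall h, inner g h = l h.
Proof.
move=> lc.
have lD u v : l (u + v) = l u + l v :> R by exact: linearD.
have lZ (a : R) u : l (a *: u) = a * (l u : R) by exact: linearZ.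
pose J z : R := `|z| ^+ 2 - 2 * (l z : R).
have J_midpoint u v :
    `|u - v| ^+ 2 = 2 * J u + 2 * J v - 4 * J (2^-1 *: (u + v)).
  rewrite /J normrZ exprMn lZ lD !sqr_normD normrN innerNr ger0_norm//.
  by field.
have J_add g h (t : R) :
    J (g + t *: h) = J g + 2 * t * (inner g h - (l h : R)) + t ^+ 2 * `|h| ^+ 2.
  rewrite /J sqr_normD lD lZ innerZr normrZ exprMn real_normK ?num_real//.
  by ring.
have [M /= M0 lM] : exists2 M : R, 0 < M & forall z, `|l z| <= M * `|z|.
  exact/pinfty_ex_gt0/linear_boundedP/continuous_linear_bounded/lc.
have hasJ : has_inf (range J).
  split; first by exists (J 0), 0.
  (* Complete the square in [J z >= |z|^2 - 2 M |z|]. *)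
  exists (- M ^+ 2) => _ [z _ <-].
  have := lM z; rewrite ler_norml => /andP[_ lz].
  have := sqr_ge0 (`|z| - M); rewrite /J; nra.
have J_ge z : inf (range J) <= J z by apply: (ge_inf hasJ.2); exists z.
have /choice[u uJ] : forall n, exists z, J z < inf (range J) + harmonic n.
  move=> n.
  have [|_ [z _ <-] zJ] := @inf_adherent _ (range J) (harmonic n) _ hasJ.
    by rewrite invr_gt0 ltr0n.
  by exists z.
have /cauchy_cvgP/cvg_ex[g ug] : cauchy (u @ \oo).
  apply: cauchy_exP => e e0.
  (* By [J_midpoint], the squared distance of [u N] and [u n] is below
     [2 * (harmonic N + harmonic n)], hence below [4 * (e ^+ 2 / 4)]. *)
  have e4 : 0 < e ^+ 2 / 4 by rewrite divr_gt0 ?exprn_gt0.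
  have /cvgr0_norm_lt/(_ _ e4)[N _ Ne] := @cvg_harmonic R.
  exists (u N); exists N => // n /= Nn; rewrite -ball_normE/=.
  rewrite -(ltr_pXn2r (n := 2)) ?nnegrE ?(ltW e0)// J_midpoint.
  have := Ne _ Nn; have := Ne _ (leqnn N).
  rewrite !ger0_norm ?harmonic_ge0// => ? ?.
  have := J_ge (2^-1 *: (u N + u n)); have := uJ N; have := uJ n.
  lra.
have J_min : J g <= inf (range J).
  have Jug : J (u n) @[n --> \oo] --> J g.
    apply: cvgB; last by apply: cvgMl_tmp; exact: cvg_comp ug (lc g).
    by apply: (continuous_cvg _ (@exprn_continuous _ _ _)); exact: cvg_norm.
  have infg : inf (range J) + harmonic n @[n --> \oo] --> inf (range J).
    by rewrite -[X in _ --> X]addr0; apply: cvgD cvg_harmonic; exact: cvg_cst.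
  by apply: (ler_cvg_to Jug infg); apply: nearW => n; exact/ltW/uJ.
(* Minimality of [g] in direction [h] gives one inequality; direction [- h] gives the other. *)
have half h : 0 <= inner g h - (l h : R).
  apply: (@ge0_of_quadratic_ge0 _ (`|h| ^+ 2)); first exact: sqr_ge0.
  by move=> t _; have := J_ge (g + t *: h); rewrite J_add; lra.
exists g => h; apply/eqP; rewrite eq_le.
have := half h; have := half (- h).
rewrite -scaleN1r innerZr lZ => ? ?; apply/andP; split; lra.
Qed.

End inner_product.

(* [R^o] rather than [R] as codomain: differentials need a normed module. *)
Definition inner_reg {R : realType} {H : hilbertType R} (u v : H) : R^o :=
  inner u v.

Lemma inner_reg_is_bilinear (R : realType) (H : hilbertType R) :
  bilinear_for (GRing.Scale.Law.clone _ _ *:%R _)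
    (GRing.Scale.Law.clone _ _ *:%R _) (@inner_reg R H).
Proof.
split=> u a v w; rewrite /inner_reg.
- by rewrite innerDl innerZl.
- by rewrite innerDr innerZr.
Qed.

HB.instance Definition _ (R : realType) (H : hilbertType R) :=
  bilinear_isBilinear.Build R H H R^o _ _ inner_reg (inner_reg_is_bilinear R H).

(** * Differential calculus of inner products *)

Section diff_inner.
Context {R : realType} {V : normedModType R} {H : hilbertType R}.

(** Product rule: the chain rule applied to the pair [(f, g)] and a continuous bilinear map. *)
Lemma is_diff_inner {f g df dg : V -> H} {x} :
  is_diff x f df -> is_diff x g dg ->
  is_diff x (fun z => inner_reg (f z) (g z))
    (fun h => inner_reg (f x) (dg h) + inner_reg (df h) (g x)).
Proof.
move=> fd gd.
have ic : continuous (fun p : H * H => inner_reg p.1 p.2) := inner_continuous.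
have idf : is_diff (f x, g x) (fun p : H * H => inner_reg p.1 p.2)
   (fun q : H * H => inner_reg (f x) q.2 + inner_reg q.1 (g x)).
  apply: DiffDef; first exact: differentiable_bilin.
  by rewrite diff_bilin.
exact: (is_diff_comp (is_diff_pair fd gd) idf).
Qed.

End diff_inner.

(** * Cone properties of the tangent cone, as required by [proj_cone_eq0] *)

Lemma tangent_cone0 (R : realType) (V : normedModType R) (M : set V) x :
  M x -> tangent_cone M x 0.
Proof.
move=> Mx; exists (fun=> x), (fun=> 0); split=> //; first exact: cvg_cst.
by under eq_fun do rewrite scale0r; exact: cvg_cst.
Qed.

Lemma tangent_coneZ (R : realType) (V : normedModType R) (M : set V)
    x d (t : R) :
  0 <= t -> tangent_cone M x d -> tangent_cone M x (t *: d).
Proof.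
move=> t0 [u [lambda [Mu lambda0 ux ud]]].
exists u, (fun k => t * lambda k); split=> // [k|]; first exact: mulr_ge0.
by under eq_fun do rewrite -scalerA; exact: cvgZl_tmp.
Qed.

(** * Projection onto cones, gradients and adjoints *)

Section optimality.
Context {R : realType} {H : hilbertType R}.

(* No projection theorem is needed: if [K] has no point nearest to [g], then
   [proj K g] is [g] itself, and [0] is polar to everything. *)
Lemma proj_cone_eq0 (K : set H) (g : H) : K 0 ->
  (forall (t : R) d, 0 <= t -> K d -> K (t *: d)) ->
  Defs.proj K g = 0 <-> polar_cone K g.
Proof.
move=> K0 KZ; rewrite /Defs.proj; split.
  case: xgetP => [_ -> [_ gmin] p0|_ g0 d _]; last by rewrite g0 inner0l.
  move=> d Kd; rewrite -oppr_ge0.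
  apply: (@ge0_of_quadratic_ge0 _ _ (`|d| ^+ 2)); first exact: sqr_ge0.
  move=> t t0; have := gmin _ (KZ _ _ (ltW t0) Kd).
  rewrite p0 subr0 -(ler_pXn2r (n := 2)) ?nnegrE// sqr_normD normrN.
  rewrite normrZ exprMn real_normK ?num_real// innerNr innerZr; lra.
(* Polarity makes [0] a nearest point, since [|g - d|^2 = |g|^2 - 2 (g, d) + |d|^2]. Any other
   nearest point [p] satisfies [|p|^2 <= 2 (g, p) <= 0]. *)
move=> gK; apply: xget_unique.
  split=> // d Kd; rewrite subr0 -(ler_pXn2r (n := 2)) ?nnegrE//.
  rewrite sqr_normD normrN innerNr; have := gK _ Kd; have := sqr_ge0 `|d|; lra.
move=> p [Kp /(_ _ K0)]; rewrite subr0.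
rewrite -(ler_pXn2r (n := 2)) ?nnegrE// sqr_normD normrN innerNr => gp.
apply/eqP; rewrite -normr_eq0 -sqrf_eq0 eq_le sqr_ge0 andbT.
have := gK _ Kp; lra.
Qed.

Lemma gradient_rep {f df : H -> R^o} {x g} :
  is_diff x f df -> (forall h, inner g h = df h) -> gradient f x = g.
Proof. by move=> fdf gdf; apply: riesz_rep => h; rewrite gdf diff_val. Qed.

(** The Riesz theorem ensures that [riesz] does not fall back on its default value [0]. *)
Lemma gradientE (f : H -> R^o) x : differentiable f x ->
  forall h, inner (gradient f x) h = 'd f x h.
Proof.
move=> fx; have [g gf] := riesz_representation _ (diff_continuous fx).
by rewrite /gradient (riesz_rep gf).
Qed.

End optimality.

Lemma adjointE (R : realType) (X Y : hilbertType R) (A : {linear X -> Y})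
    (y : Y) :
  continuous A -> forall h, inner (adjoint A y) h = inner y (A h) :> R.
Proof.
move=> Ac.
have lA : linear (fun h => inner_reg y (A h)).
  by move=> a u v; rewrite linearP linearDr linearZr_LR.
pose l : {linear X -> R^o} := HB.pack (fun h => inner_reg y (A h))
  (GRing.isLinear.Build _ _ _ _ _ lA).
have lc : continuous l.
  move=> h; apply: (@continuous2_cvg _ Y Y R^o _ _ _ _ inner_reg).
  - exact: (inner_continuous (y, A h)).
  - exact: cvg_cst.
  - exact: Ac.
have [g gl] := riesz_representation l lc.
by rewrite /adjoint (riesz_rep gl).
Qed.

(** * Gradients of the augmented Lagrangian *)

Section lagrangian.
Context {R : realType} {X Y : hilbertType R}.
Variables (phi : X -> R) (c : X -> Y) (rho : R).

Lemma grady_lagrangianE x y : grady_lagrangian phi c rho x y = c x.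
Proof.
(* The Lagrangian is affine in [y]; this convertible form matches the [is_diff] rules. *)
pose L : Y -> R^o := cst (aug_objective phi c rho x : R^o) +
  (fun z => inner_reg (id z) (cst (c x) z)).
have Ld : is_diff y L _ :=
  is_diffD (is_diff_cst _ _) (is_diff_inner (is_diff_id _) (is_diff_cst _ _)).
have -> : grady_lagrangian phi c rho x y = gradient L y by [].
apply: (gradient_rep Ld) => h /=.
by rewrite add0r linear0r add0r innerC.
Qed.

(** The penalty has differential [rho * inner (c x) ('d c x h)], which vanishes where [c x = 0]. *)
Lemma gradx_lagrangian_feasible x y :
  differentiable (phi : X -> R^o) x -> differentiable c x -> c x = 0 ->
  gradx_lagrangian phi c rho x y =
  gradient (phi : X -> R^o) x + adjoint ('d c x) y.
Proof.
move=> /[dup] phix /differentiableP phid /[dup] cx /differentiableP cd cx0.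
pose L : X -> R^o := (phi : X -> R^o) +
  (rho / 2) *: (fun z => inner_reg (c z) (c z)) +
  (fun z => inner_reg (cst y z) (c z)).
have Ld : is_diff x L _ :=
  is_diffD (is_diffD phid (is_diffZ _ (is_diff_inner cd cd)))
    (is_diff_inner (is_diff_cst _ _) cd).
have -> : gradx_lagrangian phi c rho x y = gradient L x.
  congr gradient; apply/funext => z.
  by rewrite /aug_lagrangian /aug_objective -inner_sqr_norm.
apply: (gradient_rep Ld) => h.
rewrite innerDl gradientE// adjointE; last exact: diff_continuous.
(* The differential given by [Ld], written out; the [0] is the derivative of [cst y]. *)
rewrite -[RHS]/('d phi x h +
  rho / 2 * (inner (c x) ('d c x h) + inner ('d c x h) (c x)) +
  (inner y ('d c x h) + inner 0 (c x))) cx0.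
by rewrite (innerC _ 0) !inner0l !addr0 mulr0 addr0.
Qed.

End lagrangian.

Theorem lemma5 (R : realType) (X Y : hilbertType R) (C : set X)
    (phi : X -> R) (c : X -> Y) (rho : R)
    (C_nonempty : C !=set0) (C_closed : closed C) (C_convex : convex_set C)
    (phi_C2 : twice_continuously_differentiable (phi : X -> R^o))
    (c_C2 : twice_continuously_differentiable c)
    (rho_ge0 : 0 <= rho)
    (closed_range : forall x, feasible C c x -> closed (range ('d c x)))
    (aug_bounded_below :
      (-oo < ereal_inf [set (aug_objective phi c rho x)%:E | x in C])%E)
    (aug_coercive : forall M : R, exists r : R, forall x : X,
      r < `|x| -> M < aug_objective phi c rho x)
    (c_lipschitz : locally_lipschitz c)
    (lagrangian_lipschitz : locally_lipschitz
      (fun z : X * Y => aug_lagrangian phi c rho z.1 z.2 : R^o))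
    (grad_lagrangian_lipschitz : locally_lipschitz
      (fun z : X * Y => (gradx_lagrangian phi c rho z.1 z.2,
                         grady_lagrangian phi c rho z.1 z.2))) :
  forall (x : X) (y : Y),
    equilibrium_point C phi c rho x y <-> critical_point C phi c x y.
Proof.
have dphi := phi_C2.1; have dc := c_C2.1.
move=> x y; rewrite /equilibrium_point /critical_point /flow_field /=.
(* Both sides of the theorem provide these two premises, so this equivalence serves both
   directions. *)
have stationary : C x -> c x = 0 ->
    Defs.proj (tangent_cone C x) (- gradx_lagrangian phi c rho x y) = 0 <->
    polar_cone (tangent_cone C x) (- gradient phi x - adjoint ('d c x) y).
  move=> Cx cx0; rewrite gradx_lagrangian_feasible// opprD.
  apply: proj_cone_eq0; first exact: tangent_cone0.
  by move=> t d; exact: tangent_coneZ.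
rewrite grady_lagrangianE; split=> [[Cx [px cx0]]|[[Cx cx0] crit]].
  by split=> //; exact/stationary.
by split=> //; congr pair => //; exact/stationary.
Qed.
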